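(* The scheme $\sim(\sim\sim\alpha\vee\beta)\rightarrow_{d}\sim(\alpha\vee\beta)$ is not provable in the axiom system $\mathrm{C}$; that is, there are formulas $\alpha,\beta$ such that $\sim(\sim\sim\alpha\vee\beta)\rightarrow_{d}\sim(\alpha\vee\beta)$ is not a theorem of $\mathrm{C}$.
   Context: Formulas are built from a countably infinite set of propositional variables using the unary connective $\sim$ (negation) and the binary connectives $\vee$ (disjunction), $\rightarrow_{d}$ (discussive implication), $\wedge_{d}$ (discussive conjunction), all treated as primitive. $\sim$ binds more tightly than the binary connectives. The axiom system $\mathrm{C}$ has as its sole rule modus ponens for $\rightarrow_{d}$ (from $\alpha$ and $\alpha\rightarrow_{d}\beta$ infer $\beta$), and as axioms all instances (for arbitrary formulas $\alpha,\beta,\gamma$) of the following schemes: C1: $\alpha\rightarrow_{d}(\beta\rightarrow_{d}\alpha)$. C2: $(\alpha\rightarrow_{d}(\beta\rightarrow_{d}\gamma))\rightarrow_{d}((\alpha\rightarrow_{d}\beta)\rightarrow_{d}(\alpha\rightarrow_{d}\gamma))$. C3: $(\alpha\wedge_{d}\beta)\rightarrow_{d}\alpha$. C4: $(\alpha\wedge_{d}\beta)\rightarrow_{d}\beta$. C5: $\alpha\rightarrow_{d}(\beta\rightarrow_{d}(\alpha\wedge_{d}\beta))$. C6: $\alpha\rightarrow_{d}(\alpha\vee\beta)$. C7: $\beta\rightarrow_{d}(\alpha\vee\beta)$. C8: $(\alpha\rightarrow_{d}\gamma)\rightarrow_{d}((\beta\rightarrow_{d}\gamma)\rightarrow_{d}((\alpha\vee\beta)\rightarrow_{d}\gamma))$.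 C9: $\alpha\vee(\alpha\rightarrow_{d}\beta)$. C10: $\sim(\sim\alpha\wedge_{d}(\sim\sim\alpha\wedge_{d}\sim(\alpha\vee\sim\alpha)))$. C11: $\sim(\sim\alpha\wedge_{d}(\sim\beta\wedge_{d}\sim(\alpha\vee\beta)))\rightarrow_{d}\sim(\sim\alpha\wedge_{d}(\sim\beta\wedge_{d}(\sim\gamma\wedge_{d}\sim(\alpha\vee(\beta\vee\gamma)))))$. C12: $\sim(\sim\alpha\wedge_{d}(\sim\beta\wedge_{d}(\sim\gamma\wedge_{d}\sim(\alpha\vee(\beta\vee\gamma)))))\rightarrow_{d}\sim(\sim\alpha\wedge_{d}(\sim\gamma\wedge_{d}(\sim\beta\wedge_{d}\sim(\alpha\vee(\gamma\vee\beta)))))$. C13: $\sim(\sim\alpha\wedge_{d}(\sim\beta\wedge_{d}(\sim\gamma\wedge_{d}\sim(\alpha\vee(\beta\vee\gamma)))))\rightarrow_{d}((\alpha\vee(\beta\vee\sim\gamma))\rightarrow_{d}(\alpha\vee\beta))$. C14: $\sim(\sim\alpha\wedge_{d}\sim\beta)\rightarrow_{d}(\alpha\vee\beta)$. C15: $(\alpha\vee(\beta\vee\sim\beta))\rightarrow_{d}\sim(\sim\alpha\wedge_{d}\sim(\beta\vee\sim\beta))$. A theorem of $\mathrm{C}$ is a formula derivable from these axioms by finitely many applications of modus ponens. A scheme is said to be unprovable in $\mathrm{C}$ if at least one of its instances is not a theorem of $\mathrm{C}$. *)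

(* Defs.v *)
Inductive formula : Type :=
| Var : nat -> formula
| Neg : formula -> formula
| Or : formula -> formula -> formula
| DImp : formula -> formula -> formula
| DAnd : formula -> formula -> formula.

Declare Scope discussive_scope.
Delimit Scope discussive_scope with disc.
Bind Scope discussive_scope with formula.

Notation "! a" := (Neg a)
  (at level 35, right associativity, format "! a") : discussive_scope.
Notation "a :& b" := (DAnd a b)
  (at level 61, right associativity) : discussive_scope.
Notation "a :| b" := (Or a b)
  (at level 62, right associativity) : discussive_scope.
Notation "a :-> b" := (DImp a b)
  (at level 63, right associativity) : discussive_scope.
Local Open Scope discussive_scope.

Inductive axiom_C : formula -> Prop :=
| C1 a b : axiom_C (a :-> (b :-> a))
| C2 a b c : axiom_C ((a :-> (b :-> c)) :-> ((a :-> b) :-> (a :-> c)))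
| C3 a b : axiom_C ((a :& b) :-> a)
| C4 a b : axiom_C ((a :& b) :-> b)
| C5 a b : axiom_C (a :-> (b :-> (a :& b)))
| C6 a b : axiom_C (a :-> (a :| b))
| C7 a b : axiom_C (b :-> (a :| b))
| C8 a b c : axiom_C ((a :-> c) :-> ((b :-> c) :-> ((a :| b) :-> c)))
| C9 a b : axiom_C (a :| (a :-> b))
| C10 a : axiom_C (!(!a :& (!!a :& !(a :| !a))))
| C11 a b c : axiom_C
    (!(!a :& (!b :& !(a :| b))) :->
     !(!a :& (!b :& (!c :& !(a :| (b :| c))))))
| C12 a b c : axiom_C
    (!(!a :& (!b :& (!c :& !(a :| (b :| c))))) :->
     !(!a :& (!c :& (!b :& !(a :| (c :| b))))))
| C13 a b c : axiom_C
    (!(!a :& (!b :& (!c :& !(a :| (b :| c))))) :->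
     ((a :| (b :| !c)) :-> (a :| b)))
| C14 a b : axiom_C (!(!a :& !b) :-> (a :| b))
| C15 a b : axiom_C ((a :| (b :| !b)) :-> !(!a :& !(b :| !b))).

Inductive theorem_C : formula -> Prop :=
| theorem_C_axiom a : axiom_C a -> theorem_C a
| theorem_C_mp a b : theorem_C a -> theorem_C (a :-> b) -> theorem_C b.

(* Main.v *)
(** A five-valued matrix validates C1-C15 and modus ponens and refutes an
    instance of the scheme. Its values are two falsities, two "plain" truths
    (whose negation is false) and a glut, which is true together with its
    negation. On designatedness, disjunction, implication and conjunction are
    classical, which gives C1-C9. For C10-C15 it is enough that a disjunction
    is plainly true only if one of its disjuncts is, that a disjunction of a
    glut and falsities is a glut, and that every [b :| !b] is plainly true.
    These conditions leave room for a falsity [F'] with [F' :| T] a glut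
    although [F :| T] is plainly true; since double negation sends [F] to [F'],
    replacing [a] by [!!a] changes the value of [!(a :| b)]. *)
Require Import Defs.
Local Open Scope discussive_scope.

Inductive value : Type := F | F' | G | T | T'.

Definition designated (x : value) : bool :=
  match x with F | F' => false | G | T | T' => true end.

Definition of_bool (b : bool) : value := if b then T else F.

(** Two plain truths keep [b :| !b] plainly true: [F'] would turn [T] into a glut, so [T] negates to
    [F], while [T'], whose negation is [F'], prevails over it in a disjunction. *)
Definition neg_value (x : value) : value :=
  match x with
  | F | F' | G => T'
  | T => F
  | T' => F'
  end.

Definition or_value (x y : value) : value :=
  match x, y with
  | T', _ | _, T' => T
  | F', T | T, F' => G
  | T, _ | _, T => T
  | G, _ | _, G => G
  | _, _ => F
  end.

Definition imp_value (x y : value) : value :=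
  of_bool (implb (designated x) (designated y)).

(** Never a glut, so [!(!a :& !b)] is designated exactly when [a] or [b] is plainly true; C10-C15
    are read this way. *)
Definition and_value (x y : value) : value :=
  of_bool (andb (designated x) (designated y)).

Fixpoint eval (v : nat -> value) (a : formula) : value :=
  match a with
  | Var n => v n
  | !a => neg_value (eval v a)
  | a :| b => or_value (eval v a) (eval v b)
  | a :-> b => imp_value (eval v a) (eval v b)
  | a :& b => and_value (eval v a) (eval v b)
  end.

Lemma axiom_C_designated (v : nat -> value) (a : formula) :
  axiom_C a -> designated (eval v a) = true.
Proof.
  intros H; destruct H; cbn [eval];
    repeat match goal with
      | |- context [eval v ?x] => destruct (eval v x)
      end; reflexivity.
Qed.

Lemma theorem_C_designated (v : nat -> value) (a : formula) :
  theorem_C a -> designated (eval v a) = true.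
Proof.
  induction 1 as [a Ha | a b _ IHa _ IHab].
  - now apply axiom_C_designated.
  - cbn [eval] in IHab; unfold imp_value in IHab; rewrite IHa in IHab.
    now destruct (designated (eval v b)).
Qed.

Theorem proposition2p5 :
  exists a b : formula, ~ theorem_C (!(!!a :| b) :-> !(a :| b)).
Proof.
  exists (Var 0), (Var 1); intros H.
  (* The premise negates [F' :| T], a glut, and is designated; the conclusion negates [F :| T], a
     plain truth, and is not. *)
  apply (theorem_C_designated (fun n => match n with 0 => F | _ => T end)) in H.
  discriminate H.
Qed.
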